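(* Let $\eta:\mathbb{R}^n\times\mathbb{R}^n\to\mathbb{R}^n$ and $w:\mathbb{R}^n\to\mathbb{R}^n$ be maps, let $g_1,\dots,g_m:\mathbb{R}^n\to\mathbb{R}$ be $w$-preinvex functions on $\mathbb{R}^n$ with respect to $\eta$ and $w$, and let $X=\{z\in\mathbb{R}^n : g_i(z)\le 0,\ i=1,\dots,m\}$ be a non-empty $w$-invex set with respect to $\eta$ and $w$. Let $h:\mathbb{R}^n\to\mathbb{R}$ be $w$-strictly preinvex on $X$ with respect to $\eta$ and $w$. Then the global optimal solution of the problem of minimizing $h(z)$ subject to $z\in X$ is unique, i.e. if $z_1,z_2\in X$ are both global minimizers of $h$ over $X$, then $z_1=z_2$.
   Context: Let $\eta:\mathbb{R}^n\times\mathbb{R}^n\to\mathbb{R}^n$ and $w:\mathbb{R}^n\to\mathbb{R}^n$. A non-empty set $X\subseteq\mathbb{R}^n$ is $w$-invex (with respect to $\eta$ and $w$) if $w(z_2)+\delta\,\eta(z_1,w(z_2))\in X$ for all $z_1,z_2\in X$ and $\delta\in[0,1]$. Given a $w$-invex set $X$, a function $h$ is: $w$-preinvex on $X$ if $h(w(z_2)+\delta\,\eta(z_1,w(z_2)))\le \delta h(z_1)+(1-\delta)h(z_2)$ for all $z_1,z_2\in X$ and $\delta\in[0,1]$; $w$-strictly preinvex on $X$ if $h(w(z_2)+\delta\,\eta(z_1,w(z_2)))< \delta h(z_1)+(1-\delta)h(z_2)$ for all $z_1,z_2\in X$ with $z_1\ne z_2$ and all $\delta\in(0,1)$. *)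

(* Defs.v *)
From mathcomp Require Import all_boot all_order all_algebra.
From mathcomp Require Import classical_sets reals.

Set Implicit Arguments.
Unset Strict Implicit.
Unset Printing Implicit Defensive.

Import Order.TTheory GRing.Theory Num.Theory.

Local Open Scope classical_set_scope.
Local Open Scope ring_scope.

Definition w_invex (R : realType) (n : nat)
    (eta : 'rV[R]_n -> 'rV[R]_n -> 'rV[R]_n) (w : 'rV[R]_n -> 'rV[R]_n)
    (X : set 'rV[R]_n) : Prop :=
  X !=set0 /\
  forall z1 z2 : 'rV[R]_n, X z1 -> X z2 ->
  forall delta : R, 0 <= delta <= 1 ->
    X (w z2 + delta *: eta z1 (w z2)).

(* As in the literature, the two notions below are only meant for a [w_invex]
   set [X]; that requirement is stated separately. *)
Definition w_preinvex (R : realType) (n : nat)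
    (eta : 'rV[R]_n -> 'rV[R]_n -> 'rV[R]_n) (w : 'rV[R]_n -> 'rV[R]_n)
    (X : set 'rV[R]_n) (h : 'rV[R]_n -> R) : Prop :=
  forall z1 z2 : 'rV[R]_n, X z1 -> X z2 ->
  forall delta : R, 0 <= delta <= 1 ->
    h (w z2 + delta *: eta z1 (w z2)) <= delta * h z1 + (1 - delta) * h z2.

Definition w_strictly_preinvex (R : realType) (n : nat)
    (eta : 'rV[R]_n -> 'rV[R]_n -> 'rV[R]_n) (w : 'rV[R]_n -> 'rV[R]_n)
    (X : set 'rV[R]_n) (h : 'rV[R]_n -> R) : Prop :=
  forall z1 z2 : 'rV[R]_n, X z1 -> X z2 -> z1 <> z2 ->
  forall delta : R, 0 < delta < 1 ->
    h (w z2 + delta *: eta z1 (w z2)) < delta * h z1 + (1 - delta) * h z2.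

Definition feasible_set (R : realType) (n m : nat)
    (g : 'I_m -> 'rV[R]_n -> R) : set 'rV[R]_n :=
  [set z | forall i : 'I_m, g i z <= 0].

Definition global_minimizer (R : realType) (n : nat)
    (X : set 'rV[R]_n) (h : 'rV[R]_n -> R) (z : 'rV[R]_n) : Prop :=
  X z /\ forall y : 'rV[R]_n, X y -> h z <= h y.

(* Main.v *)
Require Import Defs.
From mathcomp Require Import all_boot all_order all_algebra.
From mathcomp Require Import classical_sets reals.
From mathcomp Require Import lra.

Import Order.TTheory.

Local Open Scope classical_set_scope.
Local Open Scope ring_scope.

(** This is the classical midpoint argument for strictly convex functions, with
    [w z2 + 2^-1 *: eta z1 (w z2)] in place of the midpoint. If the minimizers [z1] and [z2]
    differed, invexity would keep this point in [X], and strict preinvexity would put its value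
    strictly below the average of [h z1] and [h z2], which is the minimum: a contradiction. *)

Lemma w_strictly_preinvex_minimizer_unique (R : realType) (n : nat)
    (eta : 'rV[R]_n -> 'rV[R]_n -> 'rV[R]_n) (w : 'rV[R]_n -> 'rV[R]_n)
    (X : set 'rV[R]_n) (h : 'rV[R]_n -> R) (z1 z2 : 'rV[R]_n) :
  w_invex eta w X -> w_strictly_preinvex eta w X h ->
  global_minimizer X h z1 -> global_minimizer X h z2 -> z1 = z2.
Proof.
move=> [_ invX] hh [Xz1 min1] [Xz2 min2].
have [//|/eqP neq12] := eqVneq z1 z2.
(* Any [delta] strictly between 0 and 1 would serve; one half is a convenient choice. *)
have half01 : 0 < (2^-1 : R) < 1 by apply/andP; split; lra.
have half01W : 0 <= (2^-1 : R) <= 1 by apply/andP; split; lra.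
have lt_mid := hh z1 z2 Xz1 Xz2 neq12 _ half01.
have le_mid := min2 _ (invX z1 z2 Xz1 Xz2 _ half01W).
have le12 := min1 z2 Xz2.
(* The chain gives [h z2 < 2^-1 * h z1 + (1 - 2^-1) * h z2], hence [h z2 < h z1], against [le12]. *)
by exfalso; move: (le_lt_trans le_mid lt_mid); lra.
Qed.

Theorem theorem4p1 (R : realType) (n m : nat)
    (eta : 'rV[R]_n -> 'rV[R]_n -> 'rV[R]_n) (w : 'rV[R]_n -> 'rV[R]_n)
    (g : 'I_m -> 'rV[R]_n -> R) (h : 'rV[R]_n -> R)
    (hg : forall i : 'I_m, w_preinvex eta w [set: 'rV[R]_n] (g i))
    (hX : w_invex eta w (feasible_set g))
    (hh : w_strictly_preinvex eta w (feasible_set g) h) :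
  forall z1 z2 : 'rV[R]_n,
    global_minimizer (feasible_set g) h z1 ->
    global_minimizer (feasible_set g) h z2 ->
    z1 = z2.
Proof. by move=> z1 z2; exact: w_strictly_preinvex_minimizer_unique hX hh. Qed.
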